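(* Let $p$ be a prime integer and let $F$ be a $\widetilde{C}_{p,m}$ field with $\operatorname{char}(F)=p$. Then the symbol length in $H_p^2(F)$ is bounded from above by $p^{m-1}-1$.
   Context: Let $F$ be a field of characteristic $p$. A homogeneous polynomial form of degree $p$ over $F$ of dimension $N$ is a homogeneous polynomial $\varphi(x_1,\dots,x_N)$ of degree $p$ with coefficients in $F$, regarded also as a function on $F^N$. It is isotropic if $\varphi(v)=0$ for some nonzero $v\in F^N$, and anisotropic otherwise. It is $p$-regular if there is no nonzero point $v\in F^N$ at which all the partial derivatives of $\varphi$ of order $p-1$ vanish simultaneously. Let $u_p(F)$ denote the maximal dimension of an anisotropic $p$-regular form over $F$. The field $F$ is called a $\widetilde{C}_{p,m}$ field if $u_p(F)\leq p^m$, that is, if every $p$-regular form over $F$ of dimension greater than $p^m$ is isotropic. $\Omega_F^1$ is the $F$-vector space of absolute differential forms, generated by symbols $da$ ($a\in F$) subject to $d(a+b)=da+db$ and $d(ab)=a\,db+b\,da$. The group $H_p^2(F)$ is the cokernel of the group homomorphism $\wp:\Omega_F^1\to\Omega_F^1/dF$ given by $\alpha\frac{d\beta}{\beta}\mapsto(\alpha^p-\alpha)\frac{d\beta}{\beta}$ for $\alpha\in F$, $\beta\in F^\times$. It is isomorphic to the $p$-torsion ${}_pBr(F)$ of the Brauer group via $\alpha\frac{d\beta}{\beta}\mapsto[\alpha,\beta)_{p,F}$, where $[\alpha,\beta)_{p,F}=F\langle x,y : x^p-x=\alpha,\ y^p=\beta,\ yxy^{-1}=x+1\rangle$ is a cyclic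 algebra of degree $p$. The symbol length of a class is the minimal number of classes $\alpha\frac{d\beta}{\beta}$ (equivalently, of cyclic algebras of degree $p$) needed to express it as a sum (equivalently, up to Brauer equivalence, as a tensor product); the symbol length of $H_p^2(F)$ is the supremum of the symbol lengths of its classes. *)

(* Defs.v *)
From HB Require Import structures.
From mathcomp Require Import all_boot all_order all_algebra.
From mathcomp Require Import generic_quotient ring_quotient.
From mathcomp.multinomials Require Import freeg mpoly.
From mathcomp Require Import boolp zify ring.

Set Implicit Arguments.
Unset Strict Implicit.
Unset Printing Implicit Defensive.

Import GRing.Theory Quotient.

Local Open Scope ring_scope.
Local Open Scope quotient_scope.

Section Forms.
Variables (F : fieldType) (N : nat).
Implicit Type phi : {mpoly F[N]}.

Definition isotropic phi : Prop :=
  exists2 v : 'rV[F]_N, v != 0 & phi.@[v 0] = 0.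

(* phi^`M[k] is the iterated formal partial derivative with multi-index k, of
   total order mdeg k; only points over F itself are considered. *)
Definition p_regular (p : nat) phi : Prop :=
  ~ exists2 v : 'rV[F]_N, v != 0 &
      forall k : 'X_{1..N}, mdeg k = p.-1 -> phi^`M[k].@[v 0] = 0.

End Forms.

(* u_p(F) <= p ^ m; the zero polynomial is p-homogeneous for p.-homog, but it is
   not p-regular in positive dimension. *)
Definition Ctilde (p m : nat) (F : fieldType) : Prop :=
  forall (N : nat) (phi : {mpoly F[N]}),
    (p ^ m < N)%N -> phi \is p.-homog -> p_regular p phi -> isotropic phi.

Section Cokernel.
Variables (U V : zmodType) (f : {additive U -> V}).

Definition imageb : {pred V} := fun y => `[< exists x, f x = y >].

Fact imageb_zmod_closed : zmod_closed imageb.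
Proof.
split; first by apply/asboolP; exists 0; rewrite raddf0.
move=> _ _ /asboolP[x <-] /asboolP[y <-].
by apply/asboolP; exists (x - y); rewrite raddfB.
Qed.

HB.instance Definition _ :=
  GRing.isZmodClosed.Build V imageb imageb_zmod_closed.

Definition coker : zmodType := {quot imageb}.

Definition to_coker : {additive V -> coker} := \pi_{quot imageb}.

Lemma to_coker_eq0 y : to_coker y = 0 <-> exists x, f x = y.
Proof.
rewrite -(raddf0 to_coker) /to_coker; split.
  move=> /eqP; rewrite -[_ == _](idealrBE imageb) subr0.
  by move=> /asboolP.
by move=> h; apply/eqP; rewrite -[_ == _](idealrBE imageb) subr0; apply/asboolP.
Qed.

Lemma to_cokerP (w : coker) : exists y, w = to_coker y.
Proof. by exists (repr w); rewrite /to_coker /= reprK. Qed.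

End Cokernel.

Section Differentials.
Variable F : fieldType.

(* The free F-module on the symbols << a >>, a : F. *)
Local Notation freeF := {freeg F / F}.

Variant leibniz_rel : freeF -> Prop :=
| LeibnizD a b : leibniz_rel (<< a + b >> - << a >> - << b >>)
| LeibnizM a b : leibniz_rel (<< a * b >> - a *: << b >> - b *: << a >>).

(* The F-submodule spanned by the relations. *)
Inductive leibniz_span : freeF -> Prop :=
| LeibnizSpan0 : leibniz_span 0
| LeibnizSpanS a r x :
    leibniz_rel r -> leibniz_span x -> leibniz_span (a *: r + x).

Definition leibniz : {pred freeF} := fun x => `[< leibniz_span x >].

Fact leibniz_submod_closed : submod_closed leibniz.
Proof.
split=> [|c x y /asboolP hx /asboolP hy]; apply/asboolP.
  exact: LeibnizSpan0.
elim: hx => [|a r z hr _ IH]; first by rewrite scaler0 add0r.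
by rewrite scalerDr scalerA -addrA; apply: LeibnizSpanS.
Qed.

HB.instance Definition _ :=
  GRing.isSubmodClosed.Build F freeF leibniz leibniz_submod_closed.

Definition Omega_quot : Type := {quot leibniz}.

HB.instance Definition _ := GRing.Zmodule.copy Omega_quot {quot leibniz}.

Definition Omega_scale (c : F) (x : Omega_quot) : Omega_quot :=
  \pi_{quot leibniz} (c *: repr x).

Fact Omega_scale_pi c (y : freeF) :
  Omega_scale c (\pi_{quot leibniz} y) = \pi_{quot leibniz} (c *: y).
Proof.
apply/eqP; rewrite -[_ == _](idealrBE leibniz) -scalerBr; apply: rpredZ.
by rewrite idealrBE reprK.
Qed.

Let piO (y : freeF) : Omega_quot := \pi_{quot leibniz} y.

Let piOP (x : Omega_quot) : exists y, x = piO y.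
Proof. by exists (repr (x : {quot leibniz})); rewrite /piO reprK. Qed.

Let piOD y z : piO (y + z) = piO y + piO z.
Proof. exact: (raddfD \pi_{quot leibniz}). Qed.

Let scE c y : Omega_scale c (piO y) = piO (c *: y).
Proof. exact: Omega_scale_pi. Qed.

Fact Omega_scaleA a b (x : Omega_quot) :
  Omega_scale a (Omega_scale b x) = Omega_scale (a * b) x.
Proof. by have [y ->] := piOP x; rewrite (scE b) (scE a) (scE _ y) scalerA. Qed.

Fact Omega_scale1 : left_id 1 Omega_scale.
Proof. by move=> x; have [y ->] := piOP x; rewrite (scE 1 y) scale1r. Qed.

Fact Omega_scaleDr : right_distributive Omega_scale +%R.
Proof.
move=> a x y; have [x' ->] := piOP x; have [y' ->] := piOP y.
by rewrite -piOD (scE a (_ + _)) (scE a x') (scE a y') scalerDr piOD.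
Qed.

Fact Omega_scaleDl (x : Omega_quot) : {morph Omega_scale^~ x : a b / a + b}.
Proof.
move=> a b; have [y ->] := piOP x.
by rewrite (scE _ y) (scE a y) (scE b y) scalerDl piOD.
Qed.

HB.instance Definition _ := GRing.Zmodule_isLmodule.Build F Omega_quot
  Omega_scaleA Omega_scale1 Omega_scaleDr Omega_scaleDl.

Definition Omega : lmodType F := Omega_quot.

Definition to_Omega (x : freeF) : Omega := \pi_{quot leibniz} x.

Fact to_Omega_is_linear : linear to_Omega.
Proof.
move=> c x y; rewrite [LHS](piOD (c *: x) y); congr (_ + _).
exact/esym/Omega_scale_pi.
Qed.

HB.instance Definition _ :=
  GRing.isLinear.Build F freeF Omega *:%R to_Omega to_Omega_is_linear.

Definition diff (a : F) : Omega := to_Omega << a >>.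

Lemma to_Omega_eq0 x : to_Omega x = 0 <-> leibniz_span x.
Proof.
rewrite -(raddf0 (@to_Omega)); split.
  by move=> /eqP; rewrite -[_ == _](idealrBE leibniz) subr0 => /asboolP.
move=> h; apply/eqP; rewrite -[_ == _](idealrBE leibniz) subr0.
exact/asboolP.
Qed.

Lemma to_OmegaP (w : Omega) : exists x, w = to_Omega x.
Proof. by exists (repr (w : {quot leibniz})); rewrite /to_Omega reprK. Qed.

Fact leibniz_rel_span x : leibniz_rel x -> leibniz_span x.
Proof.
move=> hx; rewrite -[x]addr0 -[x]scale1r.
by apply: LeibnizSpanS => //; apply: LeibnizSpan0.
Qed.

Lemma diffD a b : diff (a + b) = diff a + diff b.
Proof.
apply/eqP; rewrite -subr_eq0 opprD addrA -!raddfB; apply/eqP/to_Omega_eq0.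
exact/leibniz_rel_span/LeibnizD.
Qed.

Lemma diffM a b : diff (a * b) = a *: diff b + b *: diff a.
Proof.
apply/eqP; rewrite -subr_eq0 opprD addrA -!linearZ -!raddfB.
exact/eqP/to_Omega_eq0/leibniz_rel_span/LeibnizM.
Qed.

Fact diff_is_zmod_morphism : zmod_morphism diff.
Proof.
by move=> a b; have := diffD (a - b) b; rewrite subrK => ->; rewrite addrK.
Qed.

HB.instance Definition _ :=
  GRing.isZmodMorphism.Build F Omega diff diff_is_zmod_morphism.

End Differentials.

Section ArtinSchreier.
Variables (p : nat) (F : fieldType) (hp : p \in [pchar F]).
Local Notation freeF := {freeg F / F}.
Local Notation diff := (@diff F).

Let p_pr : prime p := pcharf_prime hp.
Let p_gt0 : (0 < p)%N := prime_gt0 p_pr.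

Fact freeF_ind (P : freeF -> Prop) :
  P 0 -> (forall k b x, P x -> P (k *: << b >> + x)) -> forall x, P x.
Proof.
move=> P0 PS x; rewrite -[x]freeg_sumE; elim/big_rec: _ => // b y _.
suff -> : << coeff b x *g b >> = coeff b x *: << b >> :> freeF by apply: PS.
by apply/eqP/freeg_eqP => z; rewrite coeffZ !coeffU mul1r.
Qed.

(* Omega with scalars restricted along Frobenius: c acts as c ^+ p. *)
Definition twisted (_ : p \in [pchar F]) : Type := Omega F.

HB.instance Definition _ := GRing.Zmodule.copy (twisted hp) (Omega F).

Definition twisted_scale (c : F) (w : twisted hp) : twisted hp :=
  (c ^+ p *: (w : Omega F) : Omega F).

Fact twisted_scaleA a b (w : twisted hp) :
  twisted_scale a (twisted_scale b w) = twisted_scale (a * b) w.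
Proof. by rewrite /twisted_scale scalerA exprMn. Qed.

Fact twisted_scale1 : left_id 1 twisted_scale.
Proof. by move=> w; rewrite /twisted_scale expr1n scale1r. Qed.

Fact twisted_scaleDr : right_distributive twisted_scale +%R.
Proof. by move=> a x y; rewrite /twisted_scale -scalerDr. Qed.

Fact twisted_scaleDl (w : twisted hp) : {morph twisted_scale^~ w : a b / a + b}.
Proof.
move=> a b; rewrite /twisted_scale -scalerDl; congr (_ *: _).
by rewrite -![_ ^+ p](pFrobenius_autE hp) raddfD.
Qed.

HB.instance Definition _ := GRing.Zmodule_isLmodule.Build F (twisted hp)
  twisted_scaleA twisted_scale1 twisted_scaleDr twisted_scaleDl.

(* The p-semilinear map << b >> |-> b ^+ p.-1 *: diff b. *)
Definition free_inv_cartier (x : freeF) : Omega F :=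
  fglift (fun b => b ^+ p.-1 *: diff b : twisted hp) x.

Fact free_inv_cartierD : {morph free_inv_cartier : x y / x + y}.
Proof.
move=> x y; pose f b : twisted hp := b ^+ p.-1 *: diff b.
pose L := GRing.isZmodMorphism.Build _ _ (fglift f) (lift_is_additive f).
pose g : {additive freeF -> twisted hp} := HB.pack (fglift f) L.
exact: (raddfD g).
Qed.

Fact free_inv_cartierU b : free_inv_cartier << b >> = b ^+ p.-1 *: diff b.
Proof.
by rewrite /free_inv_cartier liftU [LHS]/(_ *: _) /= /twisted_scale expr1n scale1r.
Qed.

Fact free_inv_cartier0 : free_inv_cartier 0 = 0.
Proof.
by apply: (@addrI _ (free_inv_cartier 0)); rewrite -free_inv_cartierD !addr0.
Qed.

Fact free_inv_cartierN x : free_inv_cartier (- x) = - free_inv_cartier x.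
Proof.
apply: (@addrI _ (free_inv_cartier x)).
by rewrite -free_inv_cartierD !subrr free_inv_cartier0.
Qed.

Fact free_inv_cartierUZ k b :
  free_inv_cartier (k *: << b >>) = k ^+ p *: (b ^+ p.-1 *: diff b).
Proof.
have -> : k *: << b >> = << k *g b >> :> freeF.
  by apply/eqP/freeg_eqP => z; rewrite coeffZ !coeffU mul1r.
by rewrite /free_inv_cartier liftU.
Qed.

Fact free_inv_cartierZ c x :
  free_inv_cartier (c *: x) = c ^+ p *: free_inv_cartier x.
Proof.
elim/freeF_ind: x => [|k b x IH].
  by rewrite scaler0 free_inv_cartier0 scaler0.
rewrite scalerDr scalerA !free_inv_cartierD IH !free_inv_cartierUZ.
by rewrite scalerDr exprMn !scalerA.
Qed.

Fact diffXn a n : diff (a ^+ n) = (n%:R * a ^+ n.-1) *: diff a.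
Proof.
elim: n => [|n IH].
  rewrite expr0 mul0r scale0r; apply: (@addrI _ (diff 1)); rewrite addr0.
  by have := diffM (1 : F) 1; rewrite mulr1 !scale1r.
rewrite exprS diffM IH scalerA -scalerDl; congr (_ *: _) => /=.
case: n {IH} => [|n] /=; first by rewrite !mul0r mulr0 add0r mul1r.
by rewrite mulrCA -exprS -[n.+2%:R]natr1 mulrDl mul1r.
Qed.

Fact diff_natl n a : diff (n%:R * a) = n%:R *: diff a.
Proof. by rewrite mulr_natl raddfMn scaler_nat. Qed.

Fact diff_pow a : diff (a ^+ p) = 0.
Proof. by rewrite diffXn (pcharf0 hp) mul0r scale0r. Qed.

(* The sum is ((a + b) ^+ p - a ^+ p - b ^+ p) / p. *)
Fact diff_binomial a b :
  diff (\sum_(i < p.-1)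
          ('C(p, i.+1) %/ p)%:R * (a ^+ (p.-1 - i) * b ^+ i.+1)) =
  (a + b) ^+ p.-1 *: diff (a + b)
    - a ^+ p.-1 *: diff a - b ^+ p.-1 *: diff b.
Proof.
have Ea (i : 'I_p.-1) : (('C(p, i.+1) %/ p) * (p.-1 - i) = 'C(p.-1, i.+1))%N.
  have hi : (p %| 'C(p, i.+1))%N.
    apply: prime_dvd_bin => //=; have := ltn_ord i; lia.
  apply/eqP; rewrite -(eqn_pmul2l p_gt0) mulnA (mulnC p) divnK //.
  have -> : (p.-1 - i = p - i.+1)%N by have := ltn_ord i; lia.
  by rewrite mulnC mul_bin_down.
have Eb (i : 'I_p.-1) : (('C(p, i.+1) %/ p) * i.+1 = 'C(p.-1, i))%N.
  have hi : (p %| 'C(p, i.+1))%N.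
    apply: prime_dvd_bin => //=; have := ltn_ord i; lia.
  apply/eqP; rewrite -(eqn_pmul2l p_gt0) mulnA (mulnC p) divnK //.
  by rewrite mul_bin_diag mulnC.
have -> : (a + b) ^+ p.-1 *: diff (a + b) - a ^+ p.-1 *: diff a
    - b ^+ p.-1 *: diff b
  = ((a + b) ^+ p.-1 - a ^+ p.-1) *: diff a
    + ((a + b) ^+ p.-1 - b ^+ p.-1) *: diff b.
  by rewrite diffD scalerDr !scalerBl addrACA -!addrA; congr (_ + _); rewrite addrCA.
rewrite raddf_sum /=.
under eq_bigr => i _.
  rewrite diff_natl diffM !diffXn scalerDr !scalerA addrC.
  over.
rewrite big_split /=; congr (_ + _); rewrite -scaler_suml; congr (_ *: _).
  rewrite exprDn big_ord_recl /= bin0 subn0 expr0 mulr1 mulr1n addrC addKr.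
  apply: eq_bigr => i _; rewrite /bump add1n subnS -[RHS]mulr_natl -Ea natrM.
  by ring.
rewrite exprDn big_ord_recr /= binn subnn expr0 mul1r mulr1n addrK.
apply: eq_bigr => i _; rewrite -[RHS]mulr_natl -Eb natrM.
by ring.
Qed.

Fact leibniz_exact x :
  leibniz_span x -> exists e, diff e = free_inv_cartier x.
Proof.
elim=> [|c r y hr _ [e he]].
  by exists 0; rewrite raddf0 free_inv_cartier0.
have [e' he'] : exists e', diff e' = free_inv_cartier r.
  case: hr => a b; last first.
    exists 0; rewrite raddf0 !(free_inv_cartierD, free_inv_cartierN).
    rewrite !free_inv_cartierZ !free_inv_cartierU diffM scalerDr !scalerA.
    have epr c' : c' ^+ p = c' ^+ p.-1 * c' by rewrite -exprSr prednK.
    rewrite !epr exprMn -addrA -opprD; apply/esym/eqP; rewrite subr_eq0.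
    by apply/eqP; congr (_ *: _ + _ *: _); ring.
  eexists; rewrite !(free_inv_cartierD, free_inv_cartierN).
  by rewrite !free_inv_cartierU -diff_binomial.
exists (c ^+ p * e' + e); rewrite raddfD /= diffM diff_pow scaler0 addr0.
by rewrite he he' free_inv_cartierD free_inv_cartierZ.
Qed.

(* The inverse Cartier map a *: dlog b |-> a ^+ p *: dlog b; it is well defined
   on Omega only modulo exact forms. *)
Definition inv_cartier (w : Omega F) : coker diff :=
  to_coker diff (free_inv_cartier (repr (w : {quot @leibniz F}))).

Lemma inv_cartierE x :
  inv_cartier (to_Omega x) = to_coker diff (free_inv_cartier x).
Proof.
set y := repr (to_Omega x : {quot @leibniz F}).
have hy : to_Omega y = to_Omega x by rewrite /y /to_Omega reprK.
have [e he] : exists e, diff e = free_inv_cartier (y - x).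
  by apply: leibniz_exact; apply/to_Omega_eq0; rewrite raddfB /= hy subrr.
apply/eqP; rewrite -subr_eq0 -raddfB; apply/eqP/to_coker_eq0.
by exists e; rewrite [LHS]he free_inv_cartierD free_inv_cartierN.
Qed.

Fact inv_cartier_is_zmod_morphism : zmod_morphism inv_cartier.
Proof.
move=> v w; have [x ->] := to_OmegaP v; have [y ->] := to_OmegaP w.
rewrite -raddfB !inv_cartierE free_inv_cartierD free_inv_cartierN.
by rewrite raddfB.
Qed.

HB.instance Definition _ := GRing.isZmodMorphism.Build
  (Omega F) (coker diff) inv_cartier inv_cartier_is_zmod_morphism.

Definition dlog (b : F) : Omega F := b^-1 *: diff b.

(* The Artin-Schreier map; wpE below gives its values on the elements
   a *: dlog b with b != 0, which generate the group Omega F. *)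
Definition wp (w : Omega F) : coker diff := inv_cartier w - to_coker diff w.

Fact wp_is_zmod_morphism : zmod_morphism wp.
Proof.
move=> v w; rewrite /wp (raddfB inv_cartier) (raddfB (to_coker _)).
by rewrite !opprD !opprK addrACA.
Qed.

HB.instance Definition _ := GRing.isZmodMorphism.Build
  (Omega F) (coker diff) wp wp_is_zmod_morphism.

Lemma wpE (a b : F) : b != 0 ->
  wp (a *: dlog b) = to_coker diff ((a ^+ p - a) *: dlog b).
Proof.
move=> b0; rewrite /wp scalerBl raddfB; congr (_ - _).
have -> : a *: dlog b = to_Omega ((a * b^-1) *: << b >>).
  by rewrite [RHS]linearZ /dlog scalerA.
rewrite inv_cartierE free_inv_cartierUZ !scalerA.
congr (to_coker _ (_ *: _)); rewrite exprMn -mulrA; congr (_ * _).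
by rewrite -{1}(prednK p_gt0) exprSr exprVn mulrAC mulVf ?expf_neq0 // mul1r.
Qed.

Definition H2p : zmodType := coker wp.

Definition symbol (a b : F) : H2p := to_coker wp (to_coker diff (a *: dlog b)).

Definition sum_of_symbols (n : nat) (c : H2p) : Prop :=
  exists a b : 'I_n -> F,
    (forall i, b i != 0) /\ c = \sum_(i < n) symbol (a i) (b i).

Lemma sum_of_symbols_exists (c : H2p) : exists n, `[< sum_of_symbols n c >].
Proof.
have [w1 ->] := to_cokerP c; have [w ->] := to_cokerP w1.
have [x ->] := to_OmegaP w; elim/freeF_ind: x => [|k b x [n /asboolP[a' [b' [h' e']]]]].
  exists 0%N; apply/asboolP; exists (fun=> 0), (fun=> 1).
  by split=> [[]//|]; rewrite big_ord0 !raddf0.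
rewrite !raddfD /= e' linearZ /= -/(diff b).
have [->|b0] := eqVneq b 0.
  exists n; apply/asboolP; exists a', b'; split=> //.
  by rewrite [diff 0]raddf0 scaler0 !raddf0 add0r.
exists n.+1; apply/asboolP.
exists (fun i => oapp a' (k * b) (unlift ord0 i)).
exists (fun i => oapp b' b (unlift ord0 i)); split=> [i|].
  by case: (unlift ord0 i) => //=.
rewrite big_ord_recl unlift_none /=; congr (_ + _).
  by rewrite /symbol /dlog scalerA mulfK.
by apply: eq_bigr => i _; rewrite liftK.
Qed.

Definition symbol_length (c : H2p) : nat := ex_minn (sum_of_symbols_exists c).

End ArtinSchreier.

(* Main.v *)
Require Import Defs.
From HB Require Import structures.
From mathcomp Require Import all_boot all_order all_algebra perm.
From mathcomp.multinomials Require Import mpoly.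
From mathcomp Require Import zify ring.
From mathcomp Require boolp.

(* Let E_i = F[x]/(x^p - x - a_i), with norm form N_i. If b is a nonzero norm from
   E_i then a_i dlog b vanishes in H_p^2(F): the operators X (multiplication
   by x) and Y (Galois twist followed by multiplication by an element of norm b)
   on E_i satisfy X Y = Y (X + 1) and Y^p = b, and unless b is a p-th power some
   X - sum_j g_j Y^j has a kernel; computing its Artin-Schreier power gives
   a_i = g_0^p - g_0 + sum_(j > 0) g_j^p b^j, and g_j^p b^j dlog b is exact.
   So b_i may be multiplied by norms, and then a_i may be replaced by a_i + b_i
   since b_i dlog b_i = d b_i.
   If no a_i has the form s^p - s, the form
     c^p - c e^(p-1) + (sum_i a_i) e^p + sum_i b_i N_i(l_i)
   in k p + 2 variables is p-regular, hence isotropic as soon as k >= p^(m-1).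
   A zero with e <> 0 makes sum_i a_i an Artin-Schreier element after such
   replacements, a zero with e = 0 makes sum_i b_i a p-th power over some of the
   indices; either relation removes one of the k symbols. *)

Set Implicit Arguments.
Unset Strict Implicit.
Unset Printing Implicit Defensive.

Import GRing.Theory.
Local Open Scope ring_scope.

(** * Rings of characteristic p *)

Section CharRing.
Variables (p : nat) (R : nzRingType) (hp : p \in [pchar R]).
Implicit Types (A W x y : R).

Lemma pcharf_exprD x y : GRing.comm x y -> (x + y) ^+ p = x ^+ p + y ^+ p.
Proof. by move=> c; rewrite -!(pFrobenius_autE hp) pFrobenius_autD_comm. Qed.

Lemma pcharf_exprN x : (- x) ^+ p = - x ^+ p.
Proof. by rewrite -!(pFrobenius_autE hp) pFrobenius_autN. Qed.

Lemma pcharf_natrX (k : nat) : k%:R ^+ p = k%:R :> R.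
Proof. by rewrite -(pFrobenius_autE hp) pFrobenius_aut_nat. Qed.

Lemma pcharf_natr_inv (k : nat) : (0 < k < p)%N -> exists u : nat, u%:R * k%:R = 1 :> R.
Proof.
case/andP=> k0 kp; have pp := pcharf_prime hp.
have /eqP cop : coprime k p by rewrite coprime_sym prime_coprime // gtnNdvd.
case: (egcdnP p k0) => u v e _; exists u.
by rewrite -natrM e cop natrD natrM (pcharf0 hp) mulr0 add0r.
Qed.

End CharRing.

Section NoncommutativeDerivative.
Variable (R : nzRingType).

Lemma deriv_exprn (P : {poly R}) (n : nat) :
  (P ^+ n)^`() = \sum_(i < n) P ^+ i * P^`() * P ^+ (n.-1 - i).
Proof.
elim: n => [|n IH]; first by rewrite expr0 derivC big_ord0.
rewrite exprSr derivM IH big_ord_recr /= subnn expr0 mulr1; congr (_ + _).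
rewrite mulr_suml; apply: eq_bigr => i _; rewrite -!mulrA -exprSr;
  congr (_ * (_ * _ ^+ _)).
by have := ltn_ord i; lia.
Qed.

End NoncommutativeDerivative.

(* Expand (A + s W)^p in the central variable s: its derivative in s is
   sum_i B^i W B^(p-1-i) = W * (((B + k)^p - B^p) / k) = W for B = A + s W, so
   only the terms of degree 0, 1 and p survive. *)
Lemma Jacobson_skew (p k : nat) (R : nzRingType) (hp : p \in [pchar R]) (A W : R) :
  (0 < k < p)%N -> A * W = W * (A + k%:R) ->
  (A + W) ^+ p - (A + W) = A ^+ p - A + W ^+ p.
Proof.
move=> kp AW; have pp := pcharf_prime hp; have p0 := prime_gt0 pp.
have hpX : p \in [pchar {poly R}].
  by rewrite inE pp /= -polyC_natr (pcharf0 hp).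
pose B : {poly R} := A%:P + W%:P * 'X.
have BW : B * W%:P = W%:P * (B + k%:R).
  rewrite /B mulrDl mulrDr mulrDr -!polyCM AW -polyC_natr -mulrA (commr_polyX W%:P).
  by rewrite mulrDr polyCD polyCM -!addrA; congr (_ + _); rewrite addrC polyCM.
have BiW i : B ^+ i * W%:P = W%:P * (B + k%:R) ^+ i.
  elim: i => [|i IH]; first by rewrite !expr0 mul1r mulr1.
  by rewrite exprS -mulrA IH mulrA BW -mulrA -exprS.
have cBk : GRing.comm B (B + k%:R) by apply: commrD => //; apply: commr_nat.
have dB : B^`() = W%:P by rewrite /B derivD derivC add0r deriv_mulC derivX mulr1.
have dBp : (B ^+ p)^`() = W%:P.
  rewrite deriv_exprn dB.
  under eq_bigr => i _ do rewrite BiW -mulrA.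
  rewrite -mulr_sumr.
  have [u uk] := pcharf_natr_inv hpX kp.
  have e : k%:R * \sum_(i < p) (B + k%:R) ^+ i * B ^+ (p.-1 - i) = k%:R :> {poly R}.
    have := subrXX_comm p (commr_sym cBk).
    have addKr' x y : x + y - x = y :> {poly R} by rewrite addrAC subrr add0r.
    rewrite (pcharf_exprD hpX) ?(pcharf_natrX hpX) ?addKr'; last exact: commr_nat.
    move=> e; rewrite [RHS]e; congr (_ * _).
    rewrite (reindex_inj rev_ord_inj) /=; apply: eq_bigr => i _.
    by congr (_ ^+ _ * _ ^+ _); have := ltn_ord i; lia.
  by have := congr1 (fun z => u%:R * z) e; rewrite mulrA uk mul1r => ->; rewrite mulr1.
have E1 : (A + W) ^+ p = (B ^+ p).[1].
  have <- : B.[1] = A + W.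
    by rewrite /B hornerD hornerC hornerMX hornerC mulr1.
  elim: (p) => [|n IH]; first by rewrite !expr0 hornerC.
  by rewrite !exprSr IH hornerM_comm // /comm_poly mulr1 mul1r.
have sB n : (size (B ^+ n) <= n.+1)%N.
  have sB1 : (size B <= 2)%N.
    rewrite /B (leq_trans (size_polyD _ _)) // geq_max (leq_trans (size_polyC_leq1 _))
      //=.
    by rewrite (leq_trans (size_polyMleq _ _)) // size_polyX addn2 ltnS size_polyC_leq1.
  elim: n => [|n IH]; first by rewrite expr0 size_poly1.
  by rewrite exprS (leq_trans (size_polyMleq _ _)) //; move: IH sB1; lia.
have C0 : (B ^+ p)`_0 = A ^+ p.
  rewrite -horner_coef0; have <- : B.[0] = A.
    by rewrite /B hornerD hornerC hornerMX mulr0 addr0.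
  elim: (p) => [|n IH]; first by rewrite !expr0 hornerC.
  by rewrite !exprSr -IH hornerM_comm // /comm_poly mulr0 mul0r.
have Cp : (B ^+ p)`_p = W ^+ p.
  elim: (p) => [|n IH]; first by rewrite !expr0 coefC.
  rewrite exprSr /B mulrDr mulrA coefD coefMX /= !coefMC IH -exprSr.
  by rewrite [_`_n.+1]nth_default ?mul0r ?add0r.
(* The derivative of [B ^+ p] is the constant W, so i times this coefficient is W or 0, and i is
   invertible below p. *)
have Ci i : (0 < i < p)%N -> (B ^+ p)`_i = if i == 1%N then W else 0.
  move=> ip; have := congr1 (fun q : {poly R} => q`_i.-1) dBp.
  rewrite coef_deriv coefC prednK; last by case/andP: ip.
  have [u ui] := pcharf_natr_inv hp ip.
  move=> e; have : u%:R * ((B ^+ p)`_i *+ i) = u%:R * (if i.-1 == 0%N then W else 0).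
    by rewrite e.
  rewrite -[_`_i *+ i]mulr_natl mulrA ui mul1r => ->.
  case: i ip ui {e} => [|[|i]] // _ ui /=; last by rewrite mulr0.
  by move: ui; rewrite mulr1 => ->; rewrite mul1r.
have -> : (A + W) ^+ p = A ^+ p + W + W ^+ p.
  rewrite E1 (horner_coef_wide _ (sB p)) big_ord_recr /= Cp expr1n mulr1; congr (_ + _).
  have p1 := prime_gt1 pp.
  transitivity (\sum_(i < p) (B ^+ p)`_i); first by apply: eq_bigr => i _;
    rewrite expr1n mulr1.
  rewrite -(big_mkord xpredT (fun i => (B ^+ p)`_i)) big_ltn // C0 big_ltn // Ci ?p1 //=.
  rewrite big_nat_cond big1 ?addr0 // => i /andP[/andP[i1 i2] _].
  by rewrite Ci ?i2 ?(ltnW i1) // gtn_eqF.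
by rewrite opprD addrA [A ^+ p + W + _]addrAC [LHS]addrAC addrK addrAC.
Qed.

(** * Proper factors of X^p - X - c and X^p - c *)

Section PolynomialFactors.
Variable F : fieldType.
Implicit Types (D : {poly F}).

Lemma coefPn_exp_XaddC (c : F) (d : nat) :
  (('X + c%:P) ^+ d.+1)`_d = d.+1%:R * c.
Proof.
elim: d => [|d IH]; first by rewrite expr1 coefD coefX coefC /= add0r mul1r.
rewrite exprSr mulrDr coefD coefMX coefMC /= IH -[d.+2%:R]natr1 mulrDl mul1r;
  congr (_ + _).
have /monicP := monic_exp d.+1 (monicXaddC c).
by rewrite lead_coefE -[c%:P]opprK -polyCN size_exp_XsubC /= => ->; rewrite mul1r.
Qed.

(** For degree below p the factor [d.+1] is invertible, so c can be read off the second highest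
    coefficient. *)
Lemma coefPn_comp_XaddC D (c : F) (d : nat) : D \is monic -> size D = d.+2 ->
  (D \Po ('X + c%:P))`_d = D`_d + d.+1%:R * c.
Proof.
move=> mD sD; rewrite coef_comp_poly sD !big_ord_recr /= coefPn_exp_XaddC.
have lD : D`_d.+1 = 1 by move/monicP: mD; rewrite lead_coefE sD.
rewrite lD mul1r; congr (_ + _).
have /monicP := monic_exp d (monicXaddC c).
rewrite lead_coefE -[c%:P]opprK -polyCN size_exp_XsubC /= => ->.
rewrite mulr1 big1 ?add0r // => i _; rewrite [X in _ * X]nth_default ?mulr0 //.
by rewrite size_exp_XsubC.
Qed.

(** Normalises a proper factor; d indexes its second highest coefficient. *)
Lemma dvdp_monic_factor D (Q : {poly F}) (p : nat) :
  Q != 0 -> D %| Q -> (1 < size D <= p)%N ->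
  exists E d, [/\ E \is monic, E %| Q, size E = d.+2 & (d.+1 < p)%N].
Proof.
move=> Q0 DQ sD; have D0 : D != 0 by apply: contraTneq sD => ->; rewrite size_poly0.
have lD : (lead_coef D)^-1 != 0 by rewrite invr_eq0 lead_coef_eq0.
exists ((lead_coef D)^-1 *: D), (size D).-2; split.
- by apply/monicP; rewrite lead_coefZ mulVf // lead_coef_eq0.
- by rewrite (eqp_dvdl _ (eqp_scale _ _)).
- by rewrite size_scale //; case: (size D) sD => [|[|]].
- by move: sD; case: (size D) => [|[|]].
Qed.

Variables (p : nat) (hp : p \in [pchar F]).

Local Notation Frob := (map_poly (pFrobenius_aut hp)).

Lemma monic_XnsubAffine (e c : F) : 'X^p - (e *: 'X + c%:P) \is monic.
Proof.
have p1 := prime_gt1 (pcharf_prime hp).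
rewrite monicE lead_coefDl ?lead_coefXn // size_polyXn size_polyN.
rewrite ltnS (leq_trans (size_polyD _ _)) // geq_max.
rewrite (leq_trans (size_scale_leq _ _)) ?size_polyX //=.
by rewrite (leq_trans (size_polyC_leq1 _)) // ltnW.
Qed.

(* E(X)^p = E^(p)(X^p), and X^p = X + c modulo E; hence E divides the monic
   polynomial E^(p)(X + c) of the same degree, so the two are equal. *)
Lemma ArtinSchreier_factor D (c : F) :
  D %| 'X^p - ('X + c%:P) -> (1 < size D <= p)%N -> exists s, c = s ^+ p - s.
Proof.
move=> DQ sD; have pp := pcharf_prime hp.
have hpX : p \in [pchar {poly F}] by rewrite pchar_poly.
have Q0 : 'X^p - ('X + c%:P) != 0.
  by have /monic_neq0 := monic_XnsubAffine 1 c; rewrite scale1r.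
have [E [d [mE EQ sE dp]]] := dvdp_monic_factor Q0 DQ sD.
have EpX : E ^+ p = Frob E \Po 'X^p.
  elim/poly_ind: E {mE EQ sE} => [|q a IH];
    first by rewrite rmorph0 comp_poly0 expr0n eqn0Ngt prime_gt0.
  rewrite (pcharf_exprD hpX); last exact: mulrC.
  rewrite exprMn IH rmorphD rmorphM /= map_polyX map_polyC /= comp_poly_MXaddC.
  by rewrite -polyC_exp -(pFrobenius_autE hp).
have ET : E %| Frob E \Po ('X + c%:P).
  have -> : Frob E \Po ('X + c%:P) = E ^+ p - (Frob E \Po 'X^p - (Frob E \Po ('X +
    c%:P))).
    by rewrite EpX subKr.
  apply: dvdp_sub; first by rewrite dvdp_exp // prime_gt0.
  apply: dvdp_trans EQ _; elim/poly_ind: (Frob E) => [|q a IH].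
    by rewrite !comp_poly0 subr0 dvdp0.
  rewrite !comp_poly_MXaddC.
  move: IH; set x := 'X^p; set y := 'X + _; set u := q \Po x; set v := q \Po y => IH.
  have -> : u * x + a%:P - (v * y + a%:P) = (u - v) * x + v * (x - y) by ring.
  by apply: dvdp_add; [apply: dvdp_mulr | apply: dvdp_mull].
have sFE : size (Frob E) = d.+2 by rewrite size_map_poly.
have mFE : Frob E \is monic by rewrite monic_map.
have sC : size (Frob E \Po ('X + c%:P)) = d.+2 by rewrite size_comp_poly2 // size_XaddC.
have mC : Frob E \Po ('X + c%:P) \is monic.
  by rewrite monicE lead_coef_comp ?size_XaddC // (monicP mFE) lead_coefXaddC expr1n
    mulr1.
have /eqP EE : E == Frob E \Po ('X + c%:P).
  by rewrite -eqp_monic // -dvdp_size_eqp // sE sC.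
(* Second highest coefficients give E_d = E_d^p + (d + 1) c; the inverse of d + 1 lies in the prime
   field, so Frobenius fixes it. *)
have := coefPn_comp_XaddC c mFE sFE; rewrite -EE coef_map /= pFrobenius_autE => e.
have [u ui] := @pcharf_natr_inv p F hp d.+1 dp.
exists (- (u%:R * E`_d)).
rewrite (pcharf_exprN hp) exprMn (pcharf_natrX hp) opprK addrC -mulrBr.
by rewrite {1}e addrAC subrr add0r mulrA ui mul1r.
Qed.

(** The Frobenius twist of a monic factor E of X^p - c divides X^p - c^p = (X - c)^p, so it is a
    power of X - c, and its second highest coefficient -(d + 1) c is a p-th power. *)
Lemma purely_inseparable_factor D (c : F) :
  D %| 'X^p - c%:P -> (1 < size D <= p)%N -> exists s, c = s ^+ p.
Proof.
move=> DQ sD; have pp := pcharf_prime hp.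
have hpX : p \in [pchar {poly F}] by rewrite pchar_poly.
have Q0 : 'X^p - c%:P != 0.
  by have /monic_neq0 := monic_XnsubAffine 0 c; rewrite scale0r add0r.
have [E [d [mE EQ sE dp]]] := dvdp_monic_factor Q0 DQ sD.
have sFE : size (Frob E) = d.+2 by rewrite size_map_poly.
have mFE : Frob E \is monic by rewrite monic_map.
have FE : Frob E = ('X - c%:P) ^+ d.+1.
  have : Frob E %| ('X - c%:P) ^+ p.
    have -> : ('X - c%:P) ^+ p = Frob ('X^p - c%:P).
      rewrite rmorphB /= map_polyXn map_polyC /= pFrobenius_autE.
      by rewrite (pcharf_exprD hpX) ?(pcharf_exprN hpX) -?polyC_exp //; apply: mulrC.
    by rewrite dvdp_map.
  case/dvdp_exp_XsubCP => k _ Ek; have := eqp_size Ek.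
  rewrite sFE size_exp_XsubC => -[->]; apply/eqP.
  by rewrite -eqp_monic ?monic_exp ?monicXsubC.
have := coefPn_exp_XaddC (- c) d; rewrite polyCN -FE coef_map /= pFrobenius_autE => e.
have [u ui] := @pcharf_natr_inv p F hp d.+1 dp.
exists (- (u%:R * E`_d)).
by rewrite (pcharf_exprN hp) exprMn (pcharf_natrX hp) e mulrA ui mul1r opprK.
Qed.

End PolynomialFactors.

(** * Artin-Schreier extensions as matrix algebras *)

Section ArtinSchreierMatrix.
Variables (q : nat) (R : comNzRingType).
Local Notation p := q.+2.
Local Notation e j := (delta_mx 0 j : 'rV[R]_p).
Implicit Types (a : R) (v : 'I_p -> R) (Z : 'M[R]_p).

(* Multiplication by x on R[x] / (x^p - x - a), in the basis of the powers of x,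
   acting on row vectors from the right. *)
Definition AS_mx a : 'M[R]_p :=
  \matrix_(i, j) if (i < q.+1)%N then (j == i.+1 :> nat)%:R
                 else a *+ (j == 0 :> nat) + (j == 1%N :> nat)%:R.

Definition AS_elt a v : 'M[R]_p := \sum_j v j *: AS_mx a ^+ j.

(** The norm form, taken over any commutative ring so that it can be evaluated at variables and at
    points of a line over [{poly F}]. *)
Definition AS_norm a v : R := \det (AS_elt a v).

Lemma delta_AS_mx_small a (i j : 'I_p) : j = i.+1 :> nat -> e i *m AS_mx a = e j.
Proof.
move=> ji; rewrite -rowE; apply/rowP => k; rewrite !mxE eqxx /=.
by rewrite -ltnS -ji ltn_ord -val_eqE /= ji.
Qed.

Lemma delta_AS_mx_max a : e ord_max *m AS_mx a = a *: e 0 + e 1.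
Proof.
rewrite -rowE; apply/rowP => k; rewrite !mxE eqxx /= ltnn.
by rewrite -!val_eqE /= mulr_natr.
Qed.

Lemma delta_AS_mxX a (j : 'I_p) : e 0 *m AS_mx a ^+ j = e j.
Proof.
case: j => j; elim: j => [|j IH] hj /=.
  by rewrite expr0 mulmx1; congr delta_mx; apply: val_inj.
by rewrite exprSr mulmxA (IH (ltnW hj)); apply: delta_AS_mx_small.
Qed.

Lemma delta_AS_mx a : e 0 *m AS_mx a = e 1.
Proof. exact: delta_AS_mx_small. Qed.

(** The row vector [e 0] is cyclic for [AS_mx a], so a matrix in its commutant is determined by its
    first row. *)
Lemma comm_AS_mx_eq0 a Z : GRing.comm (AS_mx a) Z -> e 0 *m Z = 0 -> Z = 0.
Proof.
move=> cXZ Z0; apply/row_matrixP => i; rewrite rowE row0 -(delta_AS_mxX a) -mulmxA.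
by rewrite [_ *m Z](commr_sym (commrX i (commr_sym cXZ))) mulmxA Z0 mul0mx.
Qed.

Lemma comm_AS_mx_inj a Z Z' : GRing.comm (AS_mx a) Z -> GRing.comm (AS_mx a) Z' ->
  e 0 *m Z = e 0 *m Z' -> Z = Z'.
Proof.
move=> cZ cZ' ZZ'; apply/eqP; rewrite -subr_eq0; apply/eqP.
by apply: (@comm_AS_mx_eq0 a); [apply: commrB | rewrite mulmxBr ZZ' subrr].
Qed.

Lemma AS_mxX a : AS_mx a ^+ p = AS_mx a + a%:M.
Proof.
apply: (@comm_AS_mx_inj a); first exact: commrX.
  by apply: commrD => //; apply: scalar_mxC.
have := delta_AS_mxX a ord_max => /= eX.
rewrite exprSr mulmxA eX delta_AS_mx_max mulmxDr delta_AS_mx mul_mx_scalar.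
by rewrite addrC.
Qed.

Lemma AS_elt_comm a v : GRing.comm (AS_mx a) (AS_elt a v).
Proof.
apply: commr_sum => j _; rewrite /GRing.comm -scalerAl -scalerAr.
by congr (_ *: _); apply: commrX.
Qed.

Lemma delta_AS_elt a v : e 0 *m AS_elt a v = \row_j v j.
Proof.
rewrite /AS_elt mulmx_sumr [RHS]row_sum_delta; apply: eq_bigr => j _.
by rewrite -scalemxAr delta_AS_mxX mxE.
Qed.

(** The element with the same first row also lies in the commutant, hence equals Z. *)
Lemma AS_eltP a Z : GRing.comm (AS_mx a) Z -> Z = AS_elt a (fun j => Z 0 j).
Proof.
move=> cZ; apply: (comm_AS_mx_inj cZ (AS_elt_comm a _)).
by rewrite delta_AS_elt -rowE; apply/rowP => j; rewrite !mxE.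
Qed.

Lemma AS_eltD a v w : AS_elt a (fun j => v j + w j) = AS_elt a v + AS_elt a w.
Proof. by rewrite -big_split; apply: eq_bigr => j _; rewrite scalerDl. Qed.

Lemma AS_eltZ a c v : AS_elt a (fun j => c * v j) = c *: AS_elt a v.
Proof. by rewrite scaler_sumr; apply: eq_bigr => j _; rewrite scalerA. Qed.

Lemma AS_normZ a c v : AS_norm a (fun j => c * v j) = c ^+ p * AS_norm a v.
Proof. by rewrite /AS_norm AS_eltZ detZ. Qed.

Lemma eq_AS_norm a v w : v =1 w -> AS_norm a v = AS_norm a w.
Proof.
by move=> vw; congr (\det _); apply: eq_bigr => j _; rewrite vw.
Qed.

End ArtinSchreierMatrix.

Lemma rmorph_AS_mx (q : nat) (R S : comNzRingType) (f : {rmorphism R -> S}) a :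
  map_mx f (AS_mx q a) = AS_mx q (f a).
Proof.
apply/matrixP => i j; rewrite !mxE; case: ifP => _; first by rewrite rmorph_nat.
by rewrite rmorphD !rmorphMn rmorph1.
Qed.

Lemma rmorph_AS_elt (q : nat) (R S : comNzRingType) (f : {rmorphism R -> S}) a
    (v : 'I_q.+2 -> R) :
  map_mx f (AS_elt a v) = AS_elt (f a) (f \o v).
Proof.
rewrite /AS_elt map_mx_sum; apply: eq_bigr => j _ /=.
by rewrite map_mxZ rmorphXn /= rmorph_AS_mx.
Qed.

Lemma rmorph_AS_norm (q : nat) (R S : comNzRingType) (f : {rmorphism R -> S}) a
    (v : 'I_q.+2 -> R) :
  f (AS_norm a v) = AS_norm (f a) (f \o v).
Proof. by rewrite /AS_norm -det_map_mx rmorph_AS_elt. Qed.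

Lemma skew_comm_exprn (R : nzRingType) (A Y : R) (j : nat) :
  A * Y = Y * (A + 1) -> A * Y ^+ j = Y ^+ j * (A + j%:R).
Proof.
move=> AY; elim: j => [|j IH]; first by rewrite !expr0 mulr1 mul1r addr0.
rewrite exprSr mulrA IH -!mulrA; congr (_ * _).
rewrite mulrDl AY -[j.+1%:R]natr1 !mulrDr mulr1 addrAC -addrA; congr (_ + _).
by congr (_ + _); apply/commr_sym/commr_nat.
Qed.

(** * The substitution x |-> x + 1 and the twisted operator Y *)

Section Shift.
Variables (q : nat) (F : fieldType) (hp : q.+2 \in [pchar F]).
Local Notation p := q.+2.
Local Notation e j := (delta_mx 0 j : 'rV[F]_p).

(* The substitution x |-> x + 1, which is the Galois action when
   x^p - x - a is irreducible. *)
Definition shift_mx : 'M[F]_p := \matrix_(i, j) 'C(i, j)%:R.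

Lemma mul_row_AS_mx (a : F) (w : 'rV_p) (j : 'I_p) :
  (w *m AS_mx q a) 0 j =
    if j == 0 then a * w 0 ord_max
    else w 0 (inord j.-1) + w 0 ord_max *+ (j == 1 :> nat).
Proof.
rewrite mxE big_ord_recr /= !mxE ltnn.
have E (i : 'I_q.+1) : w 0 (widen_ord (leqnSn q.+1) i) * AS_mx q a (widen_ord (leqnSn
  q.+1) i) j
    = w 0 (inord i) *+ (j == i.+1 :> nat).
  rewrite !mxE /= ltn_ord mulr_natr; congr (w 0 _ *+ _).
  by apply: val_inj; rewrite /= inordK // ltnW // ltnS ltn_ord.
rewrite (eq_bigr _ (fun i _ => E i)) -val_eqE /=.
case: j {E} => -[|j] hj /=.
  by rewrite big1 // add0r addr0 mulrC.
rewrite mulr0n add0r mulr_natr; congr (_ + _).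
rewrite (bigD1 (Ordinal (hj : (j < q.+1)%N))) //= eqxx big1 ?addr0 // => i.
by rewrite -val_eqE /= eqSS eq_sym => /negPf ->.
Qed.

(** Row i of [shift_mx] lists the coefficients of (x + 1)^i, so this is Pascal's rule; the last row
    also uses C(p, j) = 0 for 0 < j < p. *)
Lemma AS_mx_shift (a : F) : AS_mx q a * shift_mx = shift_mx * (AS_mx q a + 1).
Proof.
have bin0p j : (0 < j < p)%N -> 'C(p, j)%:R = 0 :> F.
  move=> jp; apply/eqP; rewrite -(dvdn_pcharf hp).
  by apply: prime_dvd_bin => //; apply: pcharf_prime hp.
have rowS (i : 'I_p) j : (e i *m shift_mx) 0 j = 'C(i, j)%:R by rewrite -rowE !mxE.
apply/row_matrixP => i; rewrite !rowE mulmxA [in RHS]mulmxA mulmxDr mulmx1.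
apply/rowP => j; rewrite [in RHS]mxE mul_row_AS_mx !rowS.
have [iq|iq] := ltnP i q.+1.
  rewrite (@delta_AS_mx_small _ _ _ _ (Ordinal (iq : (i.+1 < p)%N))) // rowS /=.
  rewrite (@bin_small i q.+1) // mulr0 mul0rn addr0 -val_eqE.
  case: j => -[|j] hj /=; first by rewrite !bin0 add0r.
  by rewrite inordK 1?ltnW // binS natrD addrC.
have -> : i = ord_max by apply: val_inj; have := ltn_ord i => /=; lia.
rewrite delta_AS_mx_max mulmxDl -scalemxAl mxE [X in X + _]mxE !rowS /= binn mulr1
  bin0n -val_eqE.
case: j => -[|j] hj /=; first by rewrite !bin0 mulr1.
rewrite inordK 1?ltnW // mulr0 add0r modn_small // addrAC -natrD addnC -binS.
by rewrite bin0p // add0r; case: j {hj} => [|j].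
Qed.

Lemma det_shift_mx : \det shift_mx = 1.
Proof.
rewrite det_trig; first by rewrite big1 // => i _; rewrite mxE binn.
by apply/is_trig_mxP => i j ij; rewrite mxE bin_small.
Qed.

(** If the coefficients above j vanish, then w(x + 1) - w(x) has coefficient j w_j in degree j - 1;
    so they vanish from the top down to degree 1. *)
Lemma shift_fixed_scalar (w : 'rV_p) : w *m shift_mx = w -> w = w 0 0 *: e 0.
Proof.
move=> wS; suff w0 k (j : 'I_p) : (p - k <= j)%N -> (0 < j)%N -> w 0 j = 0.
  apply/rowP => j; rewrite !mxE eqxx /= mulr_natr -val_eqE /=.
  case: (posnP j) => [j0|j0]; last by rewrite (w0 p) ?subnn // gtn_eqF.
  by congr (w 0 _); apply: val_inj.
elim: k j => [|k IH] j; first by rewrite subn0 leqNgt ltn_ord.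
move=> kj j0; have [|jk] := leqP (p - k) j; first by move/IH; apply.
have jp : (j.-1 < p)%N by have := ltn_ord j; lia.
have := congr1 (fun u : 'rV_p => u 0 (Ordinal jp)) wS.
rewrite mxE (bigD1 (Ordinal jp)) //= (bigD1 j) /=; last by rewrite -val_eqE /=; lia.
rewrite !mxE /= binn mulr1 big1 => [|i /andP[ij1 ij]]; last first.
  have [lt_ji|le_ij] := ltnP j i; first by rewrite IH ?mul0r //; lia.
  rewrite mxE bin_small ?mulr0 //=.
  by move: ij1 ij; rewrite -!val_eqE /=; lia.
rewrite addr0 => /eqP; rewrite -subr_eq0 addrAC subrr add0r mulf_eq0 => /orP[/eqP->//|].
rewrite -{1}(prednK j0) binSn prednK // -(dvdn_pcharf hp) gtnNdvd //.
Qed.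

Lemma AS_shift_relation (a : F) (v : 'I_p -> F) (Y := shift_mx * AS_elt a v) :
  AS_mx q a * Y = Y * (AS_mx q a + 1).
Proof.
rewrite /Y mulrA AS_mx_shift -!mulrA; congr (_ * _).
by rewrite mulrDl mulrDr AS_elt_comm mulr1 mul1r.
Qed.

(** Y^p commutes with X and Y, hence with the shift, so it is a polynomial in X invariant under x
    |-> x + 1, that is, a scalar c. Determinants give c^p = N^p, where N is the norm, and Frobenius
    is injective. *)
Lemma Y_exp_norm (a : F) (v : 'I_p -> F) : AS_norm a v != 0 ->
  (shift_mx * AS_elt a v) ^+ p = (AS_norm a v)%:M.
Proof.
set L := AS_elt a v => N0; set Y := shift_mx * L.
have hpM : p \in [pchar 'M[F]_p] by rewrite pchar_lalg.
have cXZ : GRing.comm (AS_mx q a) (Y ^+ p).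
  by rewrite /GRing.comm (skew_comm_exprn _ (AS_shift_relation a v)) (pcharf0 hpM) addr0.
have UL : L \in unitmx by rewrite unitmxE unitfE.
have cLZ : GRing.comm L (Y ^+ p).
  by apply/commr_sym/commr_sum => j _; rewrite /GRing.comm -scalerAl -scalerAr;
    congr (_ *: _); apply/commrX/commr_sym.
have cYZ : GRing.comm Y (Y ^+ p) by apply: commrX.
have cSZ : GRing.comm shift_mx (Y ^+ p).
  apply: (mulIr (UL : L \is a GRing.unit)).
  by rewrite -mulrA -cLZ mulrA -/Y cYZ mulrA.
have [c Zc] : exists c, Y ^+ p = c%:M.
  exists ((e 0 *m Y ^+ p) 0 0).
  apply: (comm_AS_mx_inj cXZ); first exact: scalar_mxC.
  rewrite mul_mx_scalar; apply: shift_fixed_scalar.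
  rewrite -mulmxA [_ *m shift_mx](commr_sym cSZ) mulmxA; congr (_ *m _).
  by rewrite -rowE; apply/rowP => j; rewrite !mxE bin0n; case: j => -[|j].
rewrite Zc; congr _%:M; apply: (fmorph_inj (pFrobenius_aut hp)).
rewrite [LHS](_ : _ = c ^+ p) // [RHS](_ : _ = AS_norm a v ^+ p) // -[in LHS]det_scalar
  -Zc.
rewrite -[in RHS](mul1r (AS_norm a v)) -det_shift_mx -det_mulmx.
suff detX n : \det (Y ^+ n) = \det Y ^+ n by apply: detX.
by elim: n => [|n IH]; [rewrite !expr0 det1 | rewrite exprS det_mulmx IH exprS].
Qed.

End Shift.

(** * Consequences of a norm value for a *)

Section NormValues.
Variables (q : nat) (F : fieldType) (hp : q.+2 \in [pchar F]).
Local Notation p := q.+2.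
Local Notation e j := (delta_mx 0 j : 'rV[F]_p).
Implicit Types (a : F) (v : 'I_p -> F).

Lemma horner_mx_rVpoly (A : 'M[F]_p) (u : 'rV[F]_p) :
  horner_mx A (rVpoly u) = \sum_j u 0 j *: A ^+ j.
Proof.
rewrite [rVpoly u]poly_def rmorph_sum /=; apply: eq_bigr => j _.
by rewrite linearZ /= rmorphXn /= horner_mx_X insubT //= => hj; congr (u 0 _ *: _);
  apply: val_inj.
Qed.

(** A Bezout identity between the polynomial of v and X^p - X - a would make the matrix of v
    invertible; so the two share a proper factor. *)
Lemma AS_norm_eq0 a v : AS_norm a v = 0 -> (exists j, v j != 0) ->
  exists s, a = s ^+ p - s.
Proof.
move=> N0 [j0 vj0]; pose l := rVpoly (\row_j v j); pose h := 'X^p - ('X + a%:P).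
have l0 : l != 0.
  rewrite (raddf_eq0 _ (can_inj (@rVpolyK F p))).
  by apply: contraNneq vj0 => /rowP/(_ j0); rewrite !mxE => ->.
have XL : horner_mx (AS_mx q a) l = AS_elt a v.
  by rewrite horner_mx_rVpoly; apply: eq_bigr => j _; rewrite mxE.
have Xh : horner_mx (AS_mx q a) h = 0.
  by rewrite !(rmorphB, rmorphD) /= rmorphXn /= horner_mx_X horner_mx_C AS_mxX subrr.
apply: (@ArtinSchreier_factor F p hp (gcdp l h)); first exact: dvdp_gcdr.
apply/andP; split; last first.
  by apply: leq_trans (size_poly _ _ : size l <= p)%N; apply: leq_gcdpl.
rewrite ltn_neqAle lt0n size_poly_eq0 gcdp_eq0 negb_and l0 andbT eq_sym.
apply/negP => cop; have [[u w] /= uw] := Bezout_eq1_coprimepP l h cop.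
have := congr1 (horner_mx (AS_mx q a)) uw.
rewrite rmorphD !rmorphM /= XL Xh mulr0 addr0 rmorph1 => /(congr1 determinant).
by rewrite det_mulmx -/(AS_norm a v) N0 mulr0 det1 => /eqP; rewrite eq_sym oner_eq0.
Qed.

(** If the rows [e 0 *m Y ^+ j] form a basis, [e 0 *m AS_mx q a] expands in it. A dependence is a
    polynomial of degree below p sharing a factor with X^p - b, which makes b a p-th power. *)
Lemma AS_norm_cyclic a v (b := AS_norm a v) : b != 0 -> ~ (exists s, b = s ^+ p) ->
  exists g : 'I_p -> F,
    e 0 *m AS_mx q a = e 0 *m \sum_j g j *: (shift_mx q F * AS_elt a v) ^+ j.
Proof.
move=> b0 nb; set Y := shift_mx q F * _.
have sumE (u : 'rV[F]_p) : e 0 *m (\sum_j u 0 j *: Y ^+ j) = u *m \matrix_j (e 0 *m Y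
  ^+ j).
  rewrite mulmx_sumr [in RHS](row_sum_delta u) mulmx_suml; apply: eq_bigr => j _.
  by rewrite -scalemxAr -scalemxAl -rowE rowK.
set M := \matrix_j _ in sumE.
have [UM|/negP sM] := boolP (M \in unitmx).
  exists (fun j => (e 1 *m invmx M) 0 j).
  by rewrite sumE mulmxKV // delta_AS_mx.
case: nb.
have /rowV0Pn [u] : kermx M != 0.
  by apply: contra_notN sM => /eqP; rewrite -row_free_unit -kermx_eq0 => ->.
move=> /sub_kermxP uM u0; pose l := rVpoly u; pose h := 'X^p - b%:P.
have l0 : l != 0 by rewrite (raddf_eq0 _ (can_inj (@rVpolyK F p))).
have Yl : e 0 *m horner_mx Y l = 0 by rewrite horner_mx_rVpoly sumE uM.
have Yh : horner_mx Y h = 0.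
  by rewrite rmorphB /= rmorphXn /= horner_mx_X horner_mx_C (Y_exp_norm hp b0) subrr.
apply: (@purely_inseparable_factor F p hp (gcdp l h)); first exact: dvdp_gcdr.
apply/andP; split; last first.
  by apply: leq_trans (size_poly _ _ : size l <= p)%N; apply: leq_gcdpl.
rewrite ltn_neqAle lt0n size_poly_eq0 gcdp_eq0 negb_and l0 andbT eq_sym.
apply/negP => cop; have [[s w] /= sw] := Bezout_eq1_coprimepP l h cop.
have := congr1 (fun P => e 0 *m horner_mx Y P) sw.
rewrite /= [s * l]mulrC rmorphD !rmorphM /= Yh mulr0 addr0 mulmxA Yl mul0mx rmorph1
  mulmx1.
by move=> /rowP/(_ 0); rewrite !mxE !eqxx /= => /eqP; rewrite eq_sym oner_eq0.
Qed.

(* Subtracting the monomials g_j Y^j from X one at a time keeps Z^p - Z scalar,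
   and the final operator has a nonzero kernel, so this scalar vanishes. *)
Lemma AS_norm_value a v (b := AS_norm a v) : b != 0 ->
  (exists s, b = s ^+ p) \/
  exists g : 'I_p -> F, a = (\sum_j g j ^+ p * b ^+ j) - g 0.
Proof.
move=> b0; have [|nb] := boolp.pselect (exists s, b = s ^+ p); first by left.
right; have [g] := AS_norm_cyclic b0 nb; set Y := shift_mx q F * _ => eXg.
exists g; set X := AS_mx q a in eXg.
have hpM : p \in [pchar 'M[F]_p] by rewrite pchar_lalg.
have Yp : Y ^+ p = b%:M := Y_exp_norm hp b0.
pose gn j := g (inord j).
pose A k := X - \sum_(j < k) gn j *: Y ^+ j.
have Wp (c : F) j : (c *: Y ^+ j) ^+ p = (c ^+ p * b ^+ j)%:M.
  by rewrite exprZn -exprM mulnC exprM Yp -rmorphXn /= scale_scalar_mx.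
have AW k c : A k * (c *: Y ^+ k) = c *: Y ^+ k * (A k + k%:R).
  rewrite -scalerAr -scalerAl; congr (_ *: _).
  rewrite mulrBl (skew_comm_exprn _ (AS_shift_relation hp a v)) -/Y -/X.
  rewrite !mulrDr mulrN addrAC; congr (_ - _ + _).
  apply/commr_sym/commr_sum => j _; rewrite /GRing.comm -scalerAr -scalerAl.
  by rewrite -!exprD addnC.
have AS k : A k.+1 = A k + (- gn k) *: Y ^+ k.
  by rewrite /A big_ord_recr /= opprD addrA scaleNr.
(* The scalar for j = 0 contributes g_0 - g_0^p; each later monomial satisfies the relation in
   [Jacobson_skew] with constant j and contributes only -g_j^p b^j. *)
have Ap k : (k < p)%N -> A k.+1 ^+ p - A k.+1 =
    (a - \sum_(j < k.+1) gn j ^+ p * b ^+ j + gn 0%N)%:M.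
  elim: k => [_|k IH kp].
    rewrite AS (pcharf_exprD hpM); last first.
      by rewrite expr0 /GRing.comm -scalerAr -scalerAl mulr1 mul1r.
    rewrite Wp (pcharf_exprN hp) /A big_ord0 subr0 AS_mxX big_ord1 expr0 opprD addrACA.
    rewrite -/X [X + _]addrC addrK -scaleNr opprK expr0 scalemx1 mulr1 mulr1.
    by rewrite raddfD raddfB raddfN addrA.
  rewrite AS (@Jacobson_skew p k.+1 _ hpM) //.
  rewrite Wp IH; last exact: ltnW.
  rewrite (pcharf_exprN hp) -raddfD /= [in RHS]big_ord_recr /= mulNr; congr (_%:M).
  by rewrite opprD addrA [LHS]addrAC.
have gnE (j : 'I_p) : gn j = g j by rewrite /gn inord_val.
have e0A : e 0 *m A p = 0.
  rewrite mulmxBr eXg; apply/eqP; rewrite subr_eq0; apply/eqP; congr (_ *m _).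
  by apply: eq_bigr => j _; rewrite gnE.
have := congr1 (mulmx (e 0)) (Ap q.+1 (ltnSn _)).
rewrite mulmxBr e0A subr0 exprS mulmxA e0A mul0mx mul_mx_scalar => /rowP/(_ 0).
rewrite !mxE !eqxx mulr1 => /esym/eqP; rewrite -addrA addr_eq0 opprD opprK => /eqP->.
rewrite -(gnE 0); congr (_ - _); apply: eq_bigr => j _; by rewrite gnE.
Qed.

End NormValues.

(** * Symbols *)

Section Symbols.
Variables (p : nat) (F : fieldType) (hp : p \in [pchar F]).
Implicit Types (a b c s : F) (w : Omega F).

Definition form_class w : H2p hp := to_coker (wp hp) (to_coker (@diff F) w).

Lemma form_class_is_zmod_morphism : zmod_morphism form_class.
Proof. by move=> w w'; rewrite /form_class !raddfB. Qed.

HB.instance Definition _ := GRing.isZmodMorphism.Build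
  (Omega F) (H2p hp) form_class form_class_is_zmod_morphism.

Lemma symbolE a b : symbol hp a b = form_class (a *: dlog b).
Proof. by []. Qed.

Lemma form_class_diff a : form_class (diff a) = 0.
Proof.
have -> : form_class (diff a) = to_coker (wp hp) 0; last exact: raddf0.
by congr (to_coker _ _); apply/to_coker_eq0; exists a.
Qed.

Lemma symbolDl a a' b : symbol hp (a + a') b = symbol hp a b + symbol hp a' b.
Proof. by rewrite !symbolE scalerDl raddfD. Qed.

Lemma symbol0l b : symbol hp 0 b = 0.
Proof. by rewrite symbolE scale0r raddf0. Qed.

Lemma symbol_suml (I : finType) (P : pred I) (a : I -> F) b :
  symbol hp (\sum_(i | P i) a i) b = \sum_(i | P i) symbol hp (a i) b.
Proof. by rewrite symbolE scaler_suml raddf_sum. Qed.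

Lemma dlogM b b' : b != 0 -> b' != 0 -> dlog (b * b') = dlog b + dlog b'.
Proof.
move=> b0 b'0; rewrite /dlog diffM scalerDr !scalerA addrC; congr (_ *: _ + _ *: _).
  by rewrite invfM mulfVK.
by rewrite invfM mulrAC mulVf ?mul1r.
Qed.

Lemma symbolMr a b b' : b != 0 -> b' != 0 ->
  symbol hp a (b * b') = symbol hp a b + symbol hp a b'.
Proof. by move=> b0 b'0; rewrite !symbolE dlogM // scalerDr raddfD. Qed.

Lemma symbol_wp a b : b != 0 -> symbol hp (a ^+ p - a) b = 0.
Proof.
by move=> b0; apply/to_coker_eq0; exists (a *: dlog b); rewrite -wpE.
Qed.

Lemma symbol_expr a s : symbol hp a (s ^+ p) = 0.
Proof. by rewrite symbolE /dlog (diff_pow hp) !scaler0 raddf0. Qed.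

Lemma form_class_mul_dlog c b : b != 0 ->
  form_class ((c * b) *: dlog b) = form_class (c *: diff b).
Proof. by move=> b0; rewrite /dlog scalerA mulfK. Qed.

Lemma symbol_self b : b != 0 -> symbol hp b b = 0.
Proof.
by move=> b0; rewrite symbolE -{1}[b]mul1r form_class_mul_dlog // scale1r form_class_diff.
Qed.

(** The form is the differential of c^p b^j / j, because d kills p-th powers. *)
Lemma symbol_monomial c b (j : nat) : b != 0 -> (0 < j < p)%N ->
  symbol hp (c ^+ p * b ^+ j) b = 0.
Proof.
move=> b0 jp; have [u uj] := pcharf_natr_inv hp jp.
case: j jp uj => // j _ uj.
rewrite symbolE exprSr mulrA form_class_mul_dlog //.
rewrite -(form_class_diff (c ^+ p * (u%:R * b ^+ j.+1))); congr (form_class _).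
rewrite diffM (diff_pow hp) scaler0 addr0 diff_natl diffXn !scalerA; congr (_ *: _).
by rewrite mulrA -[_ * u%:R * _]mulrA uj mulr1.
Qed.

End Symbols.

Section NormSymbols.
Variables (q : nat) (F : fieldType) (hp : q.+2 \in [pchar F]).

Lemma symbol_AS_norm (a : F) (v : 'I_q.+2 -> F) : AS_norm a v != 0 -> symbol hp a
  (AS_norm a v) = 0.
Proof.
move=> N0; have [[s ->]|[g ag]] := AS_norm_value hp N0; first exact: symbol_expr.
(* The terms with j > 0 die as exact forms, and the rest is the Artin-Schreier element g_0^p -
   g_0. *)
rewrite [X in symbol hp X](_ : a = \sum_(j | j != 0) g j ^+ q.+2 * AS_norm a v ^+ j
  + (g 0 ^+ q.+2 - g 0)).
  rewrite symbolDl symbol_wp // addr0 symbol_suml big1 // => j j0.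
  by apply: symbol_monomial => //; rewrite ltn_ord andbT lt0n.
by rewrite {1}ag (bigD1 0) //= expr0 mulr1 addrAC [LHS]addrC.
Qed.

Lemma symbol_AS_normM (a b : F) (v : 'I_q.+2 -> F) : b != 0 -> AS_norm a v != 0 ->
  symbol hp a (AS_norm a v * b) = symbol hp a b.
Proof. by move=> b0 N0; rewrite symbolMr // symbol_AS_norm // add0r. Qed.

End NormSymbols.

(** * Regularity of forms *)

Section RestrictionToLine.
Variables (F : fieldType) (N : nat).
Implicit Types (phi : {mpoly F[N]}) (v w : 'I_N -> F).

(** Restriction of phi to the line t |-> w + t v, used to test directional derivatives. *)
Definition line_poly w v phi : {poly F} :=
  mmap (@polyC F) (fun i => (w i)%:P + v i *: 'X) phi.

Lemma line_polyM w v : {morph line_poly w v : x y / x * y}.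
Proof. by move=> x y; rewrite /line_poly rmorphM. Qed.

(** Chain rule: the property passes to sums and products, so constants and variables suffice. *)
Lemma deriv_line_poly w v phi :
  (line_poly w v phi)^`() = line_poly w v (\sum_i v i *: phi^`M(i)).
Proof.
pose P x := (line_poly w v x)^`() = line_poly w v (\sum_i v i *: x^`M(i)).
have PD x y : P x -> P y -> P (x + y).
  move=> Px Py; rewrite /P /line_poly raddfD derivD.
  rewrite -/(line_poly w v x) -/(line_poly w v y) Px Py -raddfD -big_split /=.
  by congr (mmap _ _ _); apply: eq_bigr => i _; rewrite mderivD scalerDr.
have PM x y : P x -> P y -> P (x * y).
  move=> Px Py; rewrite /P line_polyM derivM Px Py -!line_polyM -raddfD.
  rewrite mulr_suml mulr_sumr -big_split; congr (mmap _ _ _); apply: eq_bigr => i _.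
  by rewrite mderivM scalerDr -scalerAl -scalerAr.
have PC c : P c%:MP.
  rewrite /P {1}/line_poly mmapC derivC big1 ?/line_poly ?raddf0 // => i _.
  by rewrite mderivC scaler0.
have PX i : P 'X_i.
  rewrite /P {1}/line_poly mmapX mmap1U derivD derivC add0r derivZ derivX alg_polyC.
  rewrite (bigD1 i) //= big1 ?addr0.
    by rewrite mderivX mnm1E eqxx scale1r -[X in 'X_[X - _]]add0m addmK mpolyX0
      -mul_mpolyC mulr1 /line_poly mmapC.
  by move=> j ji; rewrite mderivX mnm1E eq_sym (negPf ji) scale0r scaler0.
rewrite -/(P phi) [phi]mpolyE; elim/big_ind: _ => [||m _]; first exact: (PC 0).
  exact: PD.
rewrite -mul_mpolyC; apply: (PM) => //; rewrite mpolyXE_id; elim/big_ind: _ => [||i _].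
- exact: (PC 1).
- exact: PM.
by elim: (m i) => [|k IH]; [exact: (PC 1) | rewrite exprS; apply: (PM)].
Qed.

End RestrictionToLine.

Section Regularity.
Variables (p N : nat) (F : fieldType) (hp : p \in [pchar F]).
Implicit Types (phi : {mpoly F[N]}) (k : 'X_{1..N}).

(* For a form of degree p, the derivative of multi-index k with |k| = p - 1 is
   the linear form whose value at v is k! times the coefficient of X^k in the
   directional derivative along v, and k! is invertible. *)
Lemma p_regular_directional phi : phi \is p.-homog ->
  (forall v : 'rV[F]_N, \sum_i v 0 i *: phi^`M(i) = 0 -> v = 0) -> p_regular p phi.
Proof.
move=> hphi reg [v v0 dv]; case/eqP: v0; apply: reg.
have pp := pcharf_prime hp; have p0 := prime_gt0 pp.
apply/mpolyP => k; rewrite mcoeff0 raddf_sum /=.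
have [dk|dk] := eqVneq (mdeg k) p.-1; last first.
  apply: big1 => i _; rewrite mcoeffZ mcoeff_mderiv (dhomog_nemf_coeff hphi) ?mul0rn
    ?mulr0 //=.
  by apply: contraNneq dk; rewrite mdegD mdeg1 addn1 => <-.
pose fk : F := \prod_i ((k i)`!)%:R.
have fk0 : fk != 0.
  apply/prodf_neq0 => i _; rewrite -(dvdn_pcharf hp).
  have : (k i < p)%N.
    by rewrite -(prednK p0) ltnS -dk mdegE (bigD1 i) //= leq_addr.
  elim: (k i) => [|n IH] np; first by rewrite gtnNdvd // prime_gt1.
  by rewrite factS Euclid_dvdM // negb_or IH ?(ltnW np) // gtnNdvd.
have coefU i : phi^`M[k]@_U_(i) = fk * (phi^`M(i))@_k.
  rewrite mcoeff_mderivm mcoeff_mderiv -mulr_natl -[in RHS]mulr_natl mulrA; congr (_ * _).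
  rewrite natr_prod /fk (bigD1 i) //= [in RHS](bigD1 i) //= mulrAC; congr (_ * _).
    rewrite mnmDE mnm1E eqxx addn1 -natrM mulnC; congr _%:R.
    by rewrite -factS -(ffact_fact (leqnSn _)) subSnn muln1.
  apply: eq_bigr => j ji.
  by rewrite mnmDE mnm1E eq_sym (negPf ji) addn0 ffactnn.
have lin : phi^`M[k] = \sum_i phi^`M[k]@_U_(i) *: 'X_i.
  apply/mpolyP => m; rewrite raddf_sum /=.
  have [/eqP/mdeg1P[i /eqP->]|dm] := eqVneq (mdeg m) 1%N.
    rewrite (bigD1 i) //= mcoeffZ mcoeffX eqxx mulr1 big1 ?addr0 // => j ji.
    by rewrite mcoeffZ mcoeffX; case: eqP => [/mnmP/(_ j)|];
      rewrite ?mulr0 // !mnm1E eqxx eq_sym (negPf ji).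
  rewrite mcoeff_mderivm (dhomog_nemf_coeff hphi) ?mul0rn.
    rewrite big1 // => i _; rewrite mcoeffZ mcoeffX.
    by case: eqP => [e|]; rewrite ?mulr0 //; move: dm; rewrite -e mdeg1.
  by apply: contraNneq dm; rewrite /= mdegD dk; lia.
have /eqP := dv k dk; rewrite lin raddf_sum /=.
under eq_bigr => i _ do rewrite mevalZ mevalXU coefU -mulrA.
rewrite -mulr_sumr mulf_eq0 (negPf fk0) /= => /eqP e.
by rewrite -[RHS]e; apply: eq_bigr => i _; rewrite mcoeffZ mulrC.
Qed.
End Regularity.

(** * The form attached to a sum of symbols *)

Section SymbolForm.
Variables (q k : nat) (F : fieldType).
Local Notation p := q.+2.
Local Notation N := (2 + k * q.+2)%N.
Variables (al be : 'I_k -> F).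

Definition coordc : 'I_N := lshift _ 0.
Definition coorde : 'I_N := lshift _ 1.
Definition coordl (i : 'I_k) (j : 'I_p) : 'I_N := rshift 2 (mxvec_index i j).

(** The parameters R and f let one formula serve as polynomial, as value at a point and as
    restriction to a line. *)
Definition symbol_form_at (R : comNzRingType) (f : F -> R) (x : 'I_N -> R) : R :=
  x coordc ^+ p - x coordc * x coorde ^+ p.-1 + f (\sum_i al i) * x coorde ^+ p
  + \sum_i f (be i) * AS_norm (f (al i)) (fun j => x (coordl i j)).

Definition symbol_form : {mpoly F[N]} :=
  symbol_form_at (@mpolyC N F) (fun i => 'X_i).

Lemma mmap_symbol_form (R : comNzRingType) (f : {rmorphism F -> R}) x :
  mmap f x symbol_form = symbol_form_at f x.
Proof.
pose h : {rmorphism {mpoly F[N]} -> R} := mmap f x; rewrite -[mmap f x]/(h : _ -> _).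
have hX i : h 'X_i = x i by rewrite [LHS]mmapX mmap1U.
have hC c : h c%:MP = f c by apply: mmapC.
rewrite /symbol_form {1}/symbol_form_at rmorphD; congr (_ + _).
  by rewrite rmorphD rmorphB rmorphXn !rmorphM !rmorphXn !hX hC.
rewrite rmorph_sum; apply: eq_bigr => i _.
rewrite rmorphM rmorph_AS_norm !hC; congr (_ * _).
by apply: eq_AS_norm => j; apply: hX.
Qed.

Lemma meval_symbol_form x : symbol_form.@[x] = symbol_form_at idfun x.
Proof. exact: (@mmap_symbol_form F idfun). Qed.

Lemma dhomog_prodr (R : comNzRingType) (n : nat) (I : finType) (P : I -> {mpoly R[n]}) :
  (forall i, P i \is 1.-homog) -> \prod_i P i \is #|I|.-homog.
Proof.
move=> hP; rewrite cardE -(big_enum _ _ _ P) /=.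
elim: (enum I) => [|i s IH]; first by rewrite big_nil dhomog1.
by rewrite big_cons; apply: (dhomogM (hP i) IH).
Qed.

Lemma symbol_form_homog : symbol_form \is p.-homog.
Proof.
have hX i : 'X_i \is [in F[N], 1.-homog] by rewrite dhomogX /= mdeg1.
have hXn i n : 'X_i ^+ n \is [in F[N], n.-homog] by rewrite -{2}[n]mul1n dhomogMn.
rewrite /symbol_form /symbol_form_at; apply: rpredD.
  rewrite mul_mpolyC; apply: rpredD; last exact/rpredZ.
  apply: rpredB => //; exact: (dhomogM (hX _) (hXn _ p.-1)).
apply: rpred_sum => i _; rewrite mul_mpolyC; apply: rpredZ.
(* Leibniz expansion of the determinant: a product of p entries, each linear in the coordinates. *)
apply: rpred_sum => s _; rewrite -mpolyC1 -mpolyCN -rmorphXn /= mul_mpolyC; apply: rpredZ.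
suff: \prod_j AS_elt (al i)%:MP_[N] (fun l => 'X_(coordl i l)) j (s j)
    \is [in F[N], #|'I_p|.-homog] by rewrite card_ord.
apply: dhomog_prodr => j; rewrite summxE; apply: rpred_sum => l _.
rewrite -rmorph_AS_mx -rmorphXn !mxE mulrC mul_mpolyC; exact: (dhomogZ _ (hX _)).
Qed.

Definition assemble (R : Type) (xc xe : R) (xl : 'I_k -> 'I_p -> R) (n : 'I_N) : R :=
  match split n with
  | inl z => if z == 0 then xc else xe
  | inr l => mxvec (\matrix_(i, j) xl i j) 0 l
  end.

Lemma assemblec (R : Type) xc xe xl : @assemble R xc xe xl coordc = xc.
Proof. by rewrite /assemble (unsplitK (inl _)). Qed.

Lemma assemblee (R : Type) xc xe xl : @assemble R xc xe xl coorde = xe.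
Proof. by rewrite /assemble (unsplitK (inl _)). Qed.

Lemma assemblel (R : Type) xc xe xl i j : @assemble R xc xe xl (coordl i j) = xl i j.
Proof. by rewrite /assemble (unsplitK (inr _)) mxvecE mxE. Qed.

Lemma coord_eq0 (v : 'rV[F]_N) : v 0 coordc = 0 -> v 0 coorde = 0 ->
  (forall i j, v 0 (coordl i j) = 0) -> v = 0.
Proof.
move=> vc ve vl; apply/rowP => n; rewrite mxE -(splitK n); case: (split n) => [z|l] /=.
  have [->|] := eqVneq z 0; first exact: vc.
  case: z => -[|[|//]] hz // _; rewrite -[RHS]ve; congr (v 0 _); exact: val_inj.
by case/mxvec_indexP: l => i j; apply: vl.
Qed.

End SymbolForm.

(** * Regularity of this form *)

Section FormRegularity.
Variables (q : nat) (F : fieldType) (hp : q.+2 \in [pchar F]).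
Local Notation p := q.+2.

(** A zero derivative would leave X^p + constant, and Cayley-Hamilton with x^p = x + a would make x
    scalar, although it sends the first basis vector to the second. *)
Lemma char_poly_AS_mx_deriv (a : F) : (char_poly (AS_mx q a))^`() != 0.
Proof.
apply/negP => /eqP d0; set P := char_poly _ in d0.
have Pi i : (0 < i < p)%N -> P`_i = 0.
  move=> ip; have [u ui] := pcharf_natr_inv hp ip.
  have := congr1 (fun Q : {poly F} => Q`_i.-1) d0; rewrite coef_deriv coef0 prednK;
    last by case/andP: ip.
  by move/(congr1 ( *%R u%:R)); rewrite mulr0 -[_`_i *+ i]mulr_natl mulrA ui mul1r.
have sP : size P = p.+1 by apply: size_char_poly.
have mP : P`_p = 1.
  by have /monicP := char_poly_monic (AS_mx q a); rewrite lead_coefE sP.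
have PE : P = 'X^p + (P`_0)%:P.
  apply/polyP => i; rewrite coefD coefXn coefC.
  have [->|ip] := eqVneq i p; first by rewrite mP addr0.
  have [->|i0] := eqVneq i 0%N; first by rewrite add0r.
  rewrite add0r; have [li|li] := ltnP i p; first by rewrite Pi // lt0n i0.
  by rewrite nth_default // sP ltn_neqAle eq_sym ip.
have := Cayley_Hamilton (AS_mx q a); rewrite -/P PE rmorphD /= rmorphXn /= horner_mx_X.
rewrite horner_mx_C AS_mxX -addrA -raddfD /= => /(congr1 (mulmx (delta_mx 0 0 : 'rV_p))).
rewrite mulmxDr delta_AS_mx mul_mx_scalar mulmx0 => /rowP/(_ 1).
by rewrite !mxE /= mulr0 addr0 => /eqP; rewrite oner_eq0.
Qed.

Lemma deriv_exp_pchar (P : {poly F}) : (P ^+ p)^`() = 0.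
Proof.
have hpX : p \in [pchar {poly F}] by rewrite pchar_poly.
by rewrite deriv_exp mulrn_pchar.
Qed.

(** With l the element of v, w represents -x l, so the point at t is (t - x) l and its norm
    splits. *)
Lemma AS_norm_line (a : F) (v : 'I_p -> F) (w := (- (AS_mx q a * AS_elt a v)) 0) :
  AS_norm a%:P (fun j => (w j)%:P + v j *: 'X)
    = char_poly (AS_mx q a) * (AS_norm a v)%:P.
Proof.
rewrite /char_poly -det_map_mx -det_mulmx; congr (\det _).
rewrite AS_eltD; have -> : AS_elt a%:P (fun j => (w j)%:P) = map_mx polyC (AS_elt a w).
  by rewrite rmorph_AS_elt.
rewrite -AS_eltP; last by apply/commrN/commrM => //; apply: AS_elt_comm.
rewrite (_ : AS_elt a%:P _ = 'X *: map_mx polyC (AS_elt a v)); last first.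
  rewrite rmorph_AS_elt -AS_eltZ; apply: eq_bigr => j _.
  by rewrite /= -mul_polyC mulrC.
rewrite /char_poly_mx mulmxBl mul_scalar_mx addrC; congr (_ + _).
by rewrite map_mxN map_mxM.
Qed.

Variables (k : nat) (al be : 'I_k -> F).
Hypothesis be0 : forall i, be i != 0.
Hypothesis al_not_wp : forall i, ~ exists s, al i = s ^+ p - s.

(** A singular direction v gives zero derivative along every line parallel to it. Base points with e
    = 1 force its c and e parts to vanish; in block i the line of [AS_norm_line] then forces norm 0,
    hence a zero block. *)
Lemma symbol_form_regular : p_regular p (symbol_form q al be).
Proof.
apply: (p_regular_directional hp); first exact: symbol_form_homog.
move=> v dv0.
have dline w : (symbol_form_at al be (@polyC F) (fun n => (w n)%:P + v 0 n *: 'X))^`()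
  = 0.
  by rewrite -mmap_symbol_form [LHS]deriv_line_poly dv0 /line_poly raddf0.
(* With base point 0 in block i the norm is t^p times a constant. *)
have norm0 (i : 'I_k) (x : 'I_p -> {poly F}) :
    (forall j, x j = v 0 (coordl i j) *: 'X) -> ((be i)%:P * AS_norm (al i)%:P x)^`() = 0.
  move=> xE; rewrite (eq_AS_norm _ (w := fun j => 'X * (v 0 (coordl i j))%:P));
    last first.
    by move=> j; rewrite xE -mul_polyC mulrC.
  rewrite AS_normZ -(rmorph_AS_norm (@polyC F)) mulrA derivM derivC mulr0 addr0.
  by rewrite derivM derivC mul0r add0r deriv_exp_pchar mulr0 mul0r.
have deriv_bigsum (f : 'I_k -> {poly F}) : (\sum_i f i)^`() = \sum_i (f i)^`().
  exact: raddf_sum.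
(* Only the term -c e^(p-1) contributes, taken at t = 0; the base points (c0, 1) with c0 = 0 and c0
   = 1 isolate the two coordinates. *)
have ce (c0 : F) : v 0 (coordc q k) + c0 * (v 0 (coorde q k) *+ p.-1) = 0.
  have := dline (assemble c0 1 (fun _ _ => 0)).
  rewrite /symbol_form_at !assemblec !assemblee !derivD derivN deriv_exp_pchar.
  rewrite deriv_bigsum [\sum_i (_ * _)^`()]big1 => [|i _]; last by apply: norm0 => j;
    rewrite assemblel add0r.
  rewrite [(_ * _ ^+ p)^`()]derivM deriv_exp_pchar derivC mul0r mulr0 !addr0 add0r.
  rewrite derivM deriv_exp !derivD !derivC !derivZ !derivX !add0r !alg_polyC.
  move/(congr1 (fun P : {poly F} => - P.[0])).
  rewrite hornerN opprK horner0 oppr0 hornerD !hornerM hornerMn hornerM !horner_exp.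
  rewrite !hornerD !hornerC !hornerZ hornerX !mulr0 !addr0 !expr1n !mulr1.
  done.
have vc : v 0 (coordc q k) = 0 by have := ce 0; rewrite mul0r addr0.
have ve : v 0 (coorde q k) = 0.
  have := ce 1; rewrite vc add0r mul1r => /eqP; rewrite -mulr_natl mulf_eq0.
  by rewrite -(dvdn_pcharf hp) gtnNdvd //= => /eqP.
apply: (coord_eq0 vc ve) => i; pose vi j := v 0 (coordl i j).
have [N0|N0] := eqVneq (AS_norm (al i) vi) 0.
  move=> j; apply/eqP; apply: contra_notT (@al_not_wp i) => vj.
  by apply: (AS_norm_eq0 hp N0); exists j.
pose w := (- (AS_mx q (al i) * AS_elt (al i) vi)) 0.
have := dline (assemble 0 0 (fun i' j => if i' == i then w j else 0)).
rewrite /symbol_form_at !assemblec !assemblee vc ve !scale0r !addr0.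
rewrite expr0n expr0n !mul0r subr0 mulr0 !add0r deriv_bigsum (bigD1 i) //=.
rewrite big1 ?addr0 => [|i' ii']; last first.
  by apply: norm0 => j; rewrite assemblel (negPf ii') add0r.
rewrite (eq_AS_norm _ (w := fun j => (w j)%:P + vi j *: 'X)); last first.
  by move=> j; rewrite assemblel eqxx.
rewrite AS_norm_line !derivM !derivC mul0r add0r mulr0 addr0 => /eqP.
by rewrite !mulf_eq0 !polyC_eq0 (negPf (be0 i)) (negPf N0) orbF (negPf
  (char_poly_AS_mx_deriv _)).
Qed.

End FormRegularity.

(** * Shortening sums of symbols *)

Section Shortening.
Variables (p : nat) (F : fieldType) (hp : p \in [pchar F]) (k : nat).
Implicit Types (a b : 'I_k -> F) (i : 'I_k).

Lemma sum_of_symbols_drop a b i0 : (forall i, b i != 0) ->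
  symbol hp (a i0) (b i0) = 0 ->
  sum_of_symbols k.-1 (\sum_i symbol hp (a i) (b i)).
Proof.
case: k a b i0 => [|k'] a b i0 b0 s0; first by case: i0 s0.
exists (a \o lift i0), (b \o lift i0); split=> [i|]; first exact: b0.
by rewrite (bigD1_ord i0) //= s0 add0r.
Qed.

(** Adding b_i to a_i for i in T changes no symbol. The new a_i sum to s^p - s, so all b_i may be
    divided by b_(i0), and the symbol at i0 gets second entry 1. *)
Lemma sum_of_symbols_shift a b (T : pred 'I_k) (s : F) : (0 < k)%N ->
  (forall i, b i != 0) -> \sum_i a i + \sum_(i | T i) b i = s ^+ p - s ->
  sum_of_symbols k.-1 (\sum_i symbol hp (a i) (b i)).
Proof.
move=> k0 b0 ab; pose i0 := Ordinal k0; pose a' i := a i + (if T i then b i else 0).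
have -> : \sum_i symbol hp (a i) (b i) = \sum_i symbol hp (a' i) (b i / b i0).
  have a'b i : symbol hp (a i) (b i) = symbol hp (a' i) (b i / b i0) + symbol hp (a' i)
    (b i0).
    rewrite -symbolMr ?mulf_neq0 ?invr_eq0 // divfK // symbolDl.
    by case: ifP => _; rewrite ?symbol_self ?symbol0l ?addr0.
  rewrite (eq_bigr _ (fun i _ => a'b i)) big_split /= -symbol_suml.
  by rewrite [X in symbol hp X](_ : _ = s ^+ p - s) ?symbol_wp ?addr0 // big_split
    -big_mkcond.
apply: (@sum_of_symbols_drop _ _ i0) => [i|]; first by rewrite mulf_neq0 ?invr_eq0.
by rewrite divff // -(expr1n F p) symbol_expr.
Qed.

(** Since t d(s^p) = 0, the forms t b_i dlog b_i over T sum to 0, so t b_i may be added to each a_i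
    with i in T; t is chosen to make the entry at i0 zero. *)
Lemma sum_of_symbols_relation a b (T : pred 'I_k) i0 (s : F) :
  (forall i, b i != 0) -> T i0 -> \sum_(i | T i) b i = s ^+ p ->
  sum_of_symbols k.-1 (\sum_i symbol hp (a i) (b i)).
Proof.
move=> b0 Ti0 bs; pose t := - a i0 / b i0.
pose a' i := a i + (if T i then t * b i else 0).
have -> : \sum_i symbol hp (a i) (b i) = \sum_i symbol hp (a' i) (b i).
  under [RHS]eq_bigr => i _ do rewrite symbolDl.
  rewrite big_split /= -[LHS]addr0; congr (_ + _).
  transitivity (form_class hp (t *: diff (\sum_(i | T i) b i))).
    by rewrite bs (diff_pow hp) scaler0 raddf0.
  rewrite raddf_sum scaler_sumr raddf_sum [LHS]big_mkcond; apply: eq_bigr => i _.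
  case: ifP => _; last by rewrite symbol0l.
  by rewrite symbolE form_class_mul_dlog.
apply: (@sum_of_symbols_drop _ _ i0) => //.
by rewrite /a' Ti0 /t divfK // subrr symbol0l.
Qed.

End Shortening.

(** * Removing one symbol by a zero of the form *)

Section Reduction.
Variables (q : nat) (F : fieldType) (hp : q.+2 \in [pchar F]).
Local Notation p := q.+2.

Lemma sum_of_symbols_reduce (m k : nat) (a b : 'I_k -> F) :
  Ctilde p m F -> (0 < k)%N -> (p ^ m < 2 + k * p)%N -> (forall i, b i != 0) ->
  sum_of_symbols k.-1 (\sum_i symbol hp (a i) (b i)).
Proof.
move=> hF k0 mk b0.
have [[i0 [s as_]]|nwp] := boolp.pselect (exists i, exists s, a i = s ^+ p - s).
  by apply: (@sum_of_symbols_drop _ _ _ _ _ _ i0) => //; rewrite as_ symbol_wp.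
have al i : ~ exists s, a i = s ^+ p - s by move=> h; apply: nwp; exists i.
have [v v0] := hF _ _ mk (symbol_form_homog q a b) (symbol_form_regular hp b0 al).
rewrite meval_symbol_form /symbol_form_at /=.
set c := v 0 (coordc q k); set e := v 0 (coorde q k).
pose l i j := v 0 (coordl i j).
pose N (l' : 'I_k -> 'I_p -> F) i := AS_norm (a i) (l' i).
(* Multiplying b_i by a nonzero norm keeps the symbol; a block of norm 0 leaves b_i alone, so that
   all entries stay nonzero. *)
pose b' l' i := if N l' i == 0 then b i else N l' i * b i.
have b'0 l' i : b' l' i != 0 by rewrite /b'; case: ifP => [_|/negbT N0] //;
  rewrite mulf_neq0.
have bb' l' : \sum_i symbol hp (a i) (b i) = \sum_i symbol hp (a i) (b' l' i).
  apply: eq_bigr => i _; rewrite /b'; case: eqP => // /eqP N0.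
  by rewrite symbol_AS_normM.
have sumb' l' : \sum_i b i * N l' i = \sum_(i | N l' i != 0) b' l' i.
  rewrite [RHS]big_mkcond; apply: eq_bigr => i _; rewrite /b'.
  by case: eqP => [->|_]; rewrite ?mulr0 // mulrC.
have [e0|e0] := eqVneq e 0.
  rewrite e0 !expr0n !mulr0 subr0 addr0 => /eqP; rewrite addrC addr_eq0 => /eqP.
  rewrite -(pcharf_exprN hp) (sumb' l) (bb' l) => bc.
  have [[i0 N0]|Nl] := boolp.pselect (exists i0, N l i0 != 0).
    exact: (sum_of_symbols_relation hp a (b'0 l) N0 bc).
  (* All norms vanish: every block is 0, as no a_i is s^p - s, hence c = 0 too and v = 0. *)
  have {}Nl i : N l i = 0 by apply/eqP; apply: contra_notT Nl => Ni; exists i.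
  case/eqP: v0; apply: coord_eq0 => [||i j]; last 1 first.
  - apply/eqP; apply: contra_notT (al i) => vij.
    by apply: (AS_norm_eq0 hp (Nl i)); exists j.
  - move: bc; rewrite big1 => [|i]; last by rewrite Nl eqxx.
    by move/esym/eqP; rewrite expf_eq0 oppr_eq0 => /andP[_ /eqP].
  - exact: e0.
(* Dividing the zero by e gives the relation with s = -c / e. *)
move=> phi0; pose l' i j := e^-1 * l i j; rewrite (bb' l').
apply: (@sum_of_symbols_shift _ _ hp _ a (b' l') (fun i => N l' i != 0) (- (e^-1 * c)))
  => //.
rewrite -sumb' (pcharf_exprN hp) opprK.
have -> : \sum_i b i * N l' i = e^-1 ^+ p * \sum_i b i * N l i.
  by rewrite mulr_sumr; apply: eq_bigr => i _; rewrite /N AS_normZ mulrCA.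
have ep : e^-1 ^+ p * e ^+ p = 1 by rewrite exprVn mulVf // expf_neq0.
have ep1 : e^-1 ^+ p * e ^+ q.+1 = e^-1.
  by rewrite exprS -mulrA exprVn mulVf ?mulr1 // expf_neq0.
move: phi0; rewrite -/(N l _) => /(congr1 ( *%R (e^-1 ^+ p))).
rewrite mulr0 !mulrDr mulrN -exprMn [e^-1 ^+ p * (c * _)]mulrCA ep1 [e^-1 ^+ p * (_ * e
  ^+ _)]mulrCA ep.
rewrite mulr1 [c * e^-1]mulrC => phi0; apply/eqP; rewrite -subr_eq0 -[X in _ == X]phi0;
  apply/eqP.
by set X := (_ * c) ^+ _; ring.
Qed.

End Reduction.

Theorem corollary3p9 (p m : nat) (F : fieldType) (hp : p \in [pchar F])
    (hm : (0 < m)%N) (hF : Ctilde p m F) :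
  forall c : H2p hp, (symbol_length c <= p ^ (m - 1) - 1)%N.
Proof.
have := pcharf_prime hp.
case: p hp hF => [|[|q]] // hp hF _ c.
rewrite /symbol_length; case: ex_minnP => n /boolp.asboolP[a [b [b0 ->]]] minn.
rewrite leqNgt; apply/negP => hn.
have m0 : (0 < q.+2 ^ (m - 1))%N by rewrite expn_gt0.
have n0 : (0 < n)%N by lia.
(* From n >= p^(m-1) follows p^m <= n p, so the form has dimension above p^m. *)
have mn : (q.+2 ^ m < 2 + n * q.+2)%N.
  rewrite -{1}(subnK hm) addn1 expnSr; apply: (@leq_ltn_trans (n * q.+2)); last by lia.
  by rewrite leq_mul2r /=; lia.
have := sum_of_symbols_reduce hp a hF n0 mn b0.
by move/boolp.asboolP/minn; lia.
Qed.
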